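(* For $n\in\mathbb{N}$, let $\varphi_n$ be the function on $[0,\pi]$ satisfying $\varphi_n(0)=0$ and $\varphi_n'(x)=1/b_n(x)$ for all $x\in(0,\pi)$. Then the limit $\lim_{n\to\infty}\min_{[0,\pi]}\varphi_n''$ exists and its value belongs to $[-5/11,-1/7]$.
   Context: The function $b_n:(0,\pi)\to\mathbb{R}$ is given by $$b_n(x)=2\,\frac{\sin^n(x)}{\int_0^x\sin^n(u)\,du}-n\,\frac{\cos(x)}{\sin(x)},$$ so that, with $I_n(x)=\int_0^x\sin^n(u)\,du$, $$\varphi_n'(x)=\frac{\sin(x)I_n(x)}{2\sin^{n+1}(x)-n\cos(x)I_n(x)},\qquad x\in(0,\pi),$$ where the denominator is positive on $(0,\pi)$. The values of $\varphi_n'$ and $\varphi_n''$ at the endpoints $0$ and $\pi$ are understood as limits. *)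

(* Defs.v *)
From Stdlib Require Import Reals.
From Coquelicot Require Import Coquelicot.
Open Scope R_scope.

Definition sin_int (n : nat) (x : R) : R := RInt (fun u => sin u ^ n) 0 x.

Definition b_fun (n : nat) (x : R) : R :=
  2 * (sin x ^ n / sin_int n x) - INR n * (cos x / sin x).

(* Continuity on the closed interval is what makes the initial condition at 0
   meaningful, and hence the function unique on [0, PI]; values outside
   [0, PI] are unconstrained. *)
Definition is_phi (n : nat) (f : R -> R) : Prop :=
  continuous_on (fun x => 0 <= x <= PI) f /\
  f 0 = 0 /\
  (forall x, 0 < x < PI -> is_derive f x (1 / b_fun n x)).

(* [g] is the second derivative of [f] on (0, PI), and its values at 0 and PI
   are the one-sided limits, which are thereby asserted to exist and be finite.
   This determines [g] uniquely on [0, PI]. *)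
Definition is_second_derivative (f g : R -> R) : Prop :=
  (forall x, 0 < x < PI -> is_derive_n f 2 x (g x)) /\
  filterlim g (at_right 0) (locally (g 0)) /\
  filterlim g (at_left PI) (locally (g PI)).

Definition is_min_on (D : R -> Prop) (g : R -> R) (m : R) : Prop :=
  (exists x, D x /\ g x = m) /\ (forall x, D x -> m <= g x).

(* Main.v *)
Require Import Defs.
From Stdlib Require Import Reals Lra Lia.
From Coquelicot Require Import Coquelicot.
Open Scope R_scope.

(** Write s = sin x, c = cos x, I = sin_int n x and h = s b_n = 2 s^(n+1)/I - n c.
    Since I' = s^n, differentiating 1/b_n gives

      phi_n'' = 1/2 - n (s^2 + (n+2)/2 c^2) / h^2.

    The elementary inequalities (n+1) c I <= s^(n+1) <= (n+1) I on [0, PI] show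
    that h > 0 on (0, PI) and that h tends to n + 2 at 0, so that phi_n''
    extends continuously to [0, PI] and attains its minimum m_n. They also give
    h >= n |c|, hence phi_n'' >= -1/n - s^2/(n c^2): away from the window
    |cot x| < 4/sqrt n the second derivative is eventually above -1/7
    ([phi_dd_tail]).

    Inside the window put t = - sqrt n cot x, so x = PI/2 + atan (t / sqrt n).
    Then

      phi_n'' = 1/2 - (1 + t^2/2 + t^2/n) / (t + 2 S_n/A_n)^2,

    with S_n = s^n = (1 + t^2/n)^(-n/2) and A_n = sqrt n I, whose derivative in t
    is S_n/(1 + t^2/n). As n grows, S_n tends to exp(-t^2/2) uniformly on the
    window; with the asymptotics of the Wallis integrals, sqrt n I(PI/2) ->
    sqrt (PI/2), this makes A_n converge uniformly to
    sqrt (PI/2) + int_0^t exp(-u^2/2) du. So phi_n'' converges uniformly on the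
    window to an explicit function G ([CVU_phi_dd]).

    Since G(2) < -1/7 ([phi_dd_lim_2]), the minimum m_n is eventually below -1/7
    and attained inside the window. Comparing phi_n'' and phi_m'' at the same t
    then shows that (m_n) is a Cauchy sequence.

    For the lower bound ([phi_dd_lower]), a comparison argument for I gives
    h >= 2 al sqrt n s + (2 be - 1) n c whenever the quadratic form
    be p^2 + al p w + be w^2 - (al p + be w)^2 is nonnegative
    ([sin_b_ge_linear]). The two choices (3/4, 3/4) and (3/7, 1/4), together with
    h >= n |c|, yield phi_n'' >= -5/11 on all of [0, PI] once n >= 100. *)

(** * The integral of sin^n *)

Lemma le_of_deriv_nonneg (F dF : R -> R) (a b : R) :
  a <= b ->
  (forall u, a <= u <= b -> is_derive F u (dF u)) ->
  (forall u, a <= u <= b -> 0 <= dF u) -> F a <= F b.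
Proof.
  intros Hab HF HdF.
  destruct (MVT_gen F a b dF) as [c [Hc Heq]].
  - intros u Hu. rewrite Rmin_left, Rmax_right in Hu by assumption.
    apply HF; lra.
  - intros u Hu. rewrite Rmin_left, Rmax_right in Hu by assumption.
    apply derivable_continuous_pt. exists (dF u). apply is_derive_Reals, HF, Hu.
  - rewrite Rmin_left, Rmax_right in Hc by assumption.
    specialize (HdF c Hc). nra.
Qed.

Lemma continuous_sin_pow (n : nat) (x : R) : continuous (fun u => sin u ^ n) x.
Proof.
  apply (ex_derive_continuous (fun u => sin u ^ n)). auto_derive; trivial.
Qed.

Lemma is_derive_sin_int (n : nat) (x : R) : is_derive (sin_int n) x (sin x ^ n).
Proof.
  apply (is_derive_RInt (fun u => sin u ^ n) (sin_int n) 0).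
  - apply filter_forall. intro y. apply (@RInt_correct R_CompleteNormedModule).
    apply (@ex_RInt_continuous R_CompleteNormedModule).
    intros z _. apply continuous_sin_pow.
  - apply continuous_sin_pow.
Qed.

Lemma ex_derive_sin_int (n : nat) (x : R) : ex_derive (sin_int n) x.
Proof. eexists; apply is_derive_sin_int. Qed.

Lemma Derive_sin_int (n : nat) (x : R) : Derive (sin_int n) x = sin x ^ n.
Proof. apply is_derive_unique, is_derive_sin_int. Qed.

Lemma sin_int_0 (n : nat) : sin_int n 0 = 0.
Proof. apply (@RInt_point R_CompleteNormedModule). Qed.

Lemma sin_int_pos (n : nat) (x : R) : 0 < x <= PI -> 0 < sin_int n x.
Proof.
  intros Hx. apply RInt_gt_0.
  - lra.
  - intros u Hu. apply pow_lt, sin_gt_0; lra.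
  - intros u _. apply continuous_sin_pow.
Qed.

Lemma sin_int_nonneg (n : nat) (x : R) : 0 <= x <= PI -> 0 <= sin_int n x.
Proof.
  intros [[H|<-] Hx]; [left; apply sin_int_pos; lra | rewrite sin_int_0; lra].
Qed.

Lemma sin_int_le_sin_pow (n : nat) (x : R) :
  0 <= x <= PI -> INR (S n) * cos x * sin_int n x <= sin x ^ S n.
Proof.
  intros Hx.
  pose (F := fun u => sin u ^ S n - INR (S n) * cos u * sin_int n u).
  enough (F 0 <= F x) as H.
  { unfold F in H. rewrite sin_int_0, sin_0, pow_i in H by lia. lra. }
  apply (le_of_deriv_nonneg F (fun u => INR (S n) * sin u * sin_int n u)).
  - lra.
  - intros u Hu. unfold F. auto_derive.
    + apply ex_derive_sin_int.
    + rewrite Derive_sin_int. change (Init.Nat.pred (S n)) with n.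
      change (match n with O => 1 | S _ => INR n + 1 end) with (INR (S n)). ring.
  - intros u Hu. apply Rmult_le_pos; [apply Rmult_le_pos|].
    + apply pos_INR.
    + apply sin_ge_0; lra.
    + apply sin_int_nonneg; lra.
Qed.

Lemma sin_pow_le_sin_int (n : nat) (x : R) :
  0 <= x <= PI -> sin x ^ S n <= INR (S n) * sin_int n x.
Proof.
  intros Hx.
  pose (F := fun u => INR (S n) * sin_int n u - sin u ^ S n).
  enough (F 0 <= F x) as H.
  { unfold F in H. rewrite sin_int_0, sin_0, pow_i in H by lia. lra. }
  apply (le_of_deriv_nonneg F (fun u => INR (S n) * sin u ^ n * (1 - cos u))).
  - lra.
  - intros u Hu. unfold F. auto_derive.
    + apply ex_derive_sin_int.
    + rewrite Derive_sin_int. change (Init.Nat.pred (S n)) with n.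
      change (match n with O => 1 | S _ => INR n + 1 end) with (INR (S n)). ring.
  - intros u Hu. apply Rmult_le_pos; [apply Rmult_le_pos|].
    + apply pos_INR.
    + apply pow_le, sin_ge_0; lra.
    + pose proof (COS_bound u); lra.
Qed.

(** The left-hand factor vanishes at most once on (0, PI), from positive to
    negative. While it is positive, sin^(n+1) divided by it vanishes at 0 and
    has derivative at least sin^n, by the condition on the quadratic form at
    p = sin x and w = sqrt n * cos x. *)
Lemma linear_sin_int_le (al be : R) (n : nat) (x : R) :
  0 < be ->
  (forall p w, (al * p + be * w) ^ 2 <= be * p ^ 2 + al * p * w + be * w ^ 2) ->
  (0 < n)%nat -> 0 < x < PI ->
  (al * sqrt (INR n) * sin x + be * INR n * cos x) * sin_int n x <= sin x ^ S n.
Proof.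
  intros Hbe Hq Hn Hx.
  assert (HN : 0 < INR n) by (apply lt_0_INR; lia).
  assert (HI : 0 < sin_int n x) by (apply sin_int_pos; lra).
  assert (Hs : 0 < sin x) by (apply sin_gt_0; lra).
  assert (Hr : sqrt (INR n) * sqrt (INR n) = INR n) by (apply sqrt_sqrt; lra).
  assert (Hr0 : 0 < sqrt (INR n)) by (apply sqrt_lt_R0; lra).
  set (r := sqrt (INR n)) in *.
  pose (P := fun u => al * r * sin u + be * INR n * cos u).
  change ((P x) * sin_int n x <= sin x ^ S n).
  destruct (Rle_or_lt (P x) 0) as [HP | HP].
  { pose proof (pow_lt (sin x) (S n) Hs). nra. }
  (* [P / sin] decreases on (0, PI), since cot does. *)
  assert (HPu : forall u, 0 <= u <= x -> 0 < P u).
  { intros u Hu.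
    assert (Hsu : 0 <= sin u) by (apply sin_ge_0; lra).
    assert (Hd : 0 <= sin (x - u)) by (apply sin_ge_0; lra).
    rewrite sin_minus in Hd.
    assert (Hid : P u * sin x
       = P x * sin u + be * INR n * (sin x * cos u - cos x * sin u))
      by (unfold P; ring).
    destruct Hsu as [Hsu | Hsu].
    - apply Rmult_lt_reg_r with (sin x); [assumption|].
      rewrite Rmult_0_l, Hid.
      apply Rplus_lt_le_0_compat; [apply Rmult_lt_0_compat; assumption|].
      apply Rmult_le_pos; [|assumption]. apply Rmult_le_pos; lra.
    - assert (Hu0 : u = 0).
      { destruct (proj1 Hu) as [H0 | H0]; [|easy].
        assert (0 < sin u) by (apply sin_gt_0; lra). lra. }
      subst u. unfold P. rewrite sin_0, cos_0. nra. }
  pose (F := fun u => sin u ^ S n / P u - sin_int n u).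
  pose (dF := fun u => sin u ^ n *
     ((INR (S n) * cos u * P u - sin u * (al * r * cos u - be * INR n * sin u))
       / P u ^ 2 - 1)).
  assert (H : F 0 <= F x).
  { apply (le_of_deriv_nonneg F dF); [lra| |].
    - intros u Hu. specialize (HPu u Hu). unfold F, dF, P in *. auto_derive.
      + repeat split; [lra | apply ex_derive_sin_int].
      + rewrite Derive_sin_int. change (Init.Nat.pred (S n)) with n.
        change (match n with O => 1 | S _ => INR n + 1 end) with (INR (S n)).
        rewrite <- tech_pow_Rmult. field. lra.
    - intros u Hu. specialize (HPu u Hu). unfold dF.
      apply Rmult_le_pos; [apply pow_le, sin_ge_0; lra|].
      apply Rge_le, Rge_minus, Rle_ge. apply Rmult_le_reg_r with (P u ^ 2).
      { apply pow_lt, HPu. }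
      unfold Rdiv. rewrite Rmult_assoc, Rinv_l, Rmult_1_r, Rmult_1_l
        by (apply pow_nonzero; lra).
      specialize (Hq (sin u) (r * cos u)).
      pose proof (sin2_cos2 u) as Htrig. unfold Rsqr in Htrig.
      rewrite S_INR.
      assert (E1 : P u ^ 2 = INR n * (al * sin u + be * (r * cos u)) ^ 2).
      { unfold P. rewrite <- Hr. ring. }
      assert (E2 : (INR n + 1) * cos u * P u
                   - sin u * (al * r * cos u - be * INR n * sin u)
        = INR n * (be * (sin u * sin u + cos u * cos u)
                   + al * sin u * (r * cos u) + be * (r * cos u) ^ 2)).
      { unfold P. replace ((r * cos u) ^ 2) with (INR n * (cos u * cos u)).
        - ring. - rewrite <- Hr. ring. }
      rewrite E1, E2. apply Rmult_le_compat_l; [lra|].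
      assert (0 <= be * (cos u * cos u)) by (apply Rmult_le_pos; nra).
      nra. }
  unfold F in H. rewrite sin_int_0, sin_0, pow_i in H by lia.
  unfold Rdiv in H at 1. rewrite Rmult_0_l in H.
  apply Rmult_le_reg_r with (/ P x); [apply Rinv_0_lt_compat, HP|].
  unfold Rdiv in H. rewrite Rmult_assoc, (Rmult_comm (sin_int n x)), <- Rmult_assoc.
  rewrite Rinv_r by lra. lra.
Qed.

(** * The second derivative on [0, PI] *)

(** The product sin * b_n, extended by its limit n + 2 at 0. On the negative
    side it is constant, so that continuity on [0, PI] is two-sided at 0. *)
Definition sin_b (n : nat) (x : R) : R :=
  if Rle_dec x 0 then INR n + 2
  else 2 * (sin x ^ S n / sin_int n x) - INR n * cos x.

Lemma sin_b_0 (n : nat) : sin_b n 0 = INR n + 2.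
Proof. unfold sin_b. destruct (Rle_dec 0 0); lra. Qed.

Lemma sin_b_gt0 (n : nat) (x : R) : 0 < x ->
  sin_b n x = 2 * (sin x ^ S n / sin_int n x) - INR n * cos x.
Proof. intros Hx. unfold sin_b. destruct (Rle_dec x 0); lra. Qed.

Lemma sin_b_PI (n : nat) : sin_b n PI = INR n.
Proof.
  rewrite sin_b_gt0 by apply PI_RGT_0.
  rewrite sin_PI, cos_PI, pow_i by lia. unfold Rdiv. ring.
Qed.

Lemma sin_b_eq (n : nat) (x : R) : 0 < x < PI -> b_fun n x = sin_b n x / sin x.
Proof.
  intros Hx. assert (0 < sin x) by (apply sin_gt_0; lra).
  assert (0 < sin_int n x) by (apply sin_int_pos; lra).
  rewrite sin_b_gt0 by lra. unfold b_fun. simpl. field. lra.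
Qed.

Lemma sin_b_lower (n : nat) (x : R) :
  0 <= x <= PI -> (INR n + 2) * cos x <= sin_b n x.
Proof.
  intros Hx. destruct (proj1 Hx) as [H0 | <-].
  - rewrite sin_b_gt0 by assumption.
    assert (HI : 0 < sin_int n x) by (apply sin_int_pos; lra).
    pose proof (sin_int_le_sin_pow n x Hx) as H. rewrite S_INR in H.
    apply Rle_div_r in H; [|assumption]. lra.
  - rewrite sin_b_0, cos_0. lra.
Qed.

Lemma sin_b_upper (n : nat) (x : R) :
  0 <= x <= PI -> sin_b n x <= 2 * (INR n + 1) - INR n * cos x.
Proof.
  intros Hx. destruct (proj1 Hx) as [H0 | <-].
  - rewrite sin_b_gt0 by assumption.
    assert (HI : 0 < sin_int n x) by (apply sin_int_pos; lra).
    pose proof (sin_pow_le_sin_int n x Hx) as H. rewrite S_INR in H.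
    apply Rle_div_l in H; [|assumption]. lra.
  - rewrite sin_b_0, cos_0. lra.
Qed.

Lemma sin_b_lower_neg (n : nat) (x : R) :
  0 < x < PI -> - INR n * cos x < sin_b n x.
Proof.
  intros Hx. rewrite sin_b_gt0 by lra.
  enough (0 < sin x ^ S n / sin_int n x) by lra.
  apply Rdiv_lt_0_compat; [apply pow_lt, sin_gt_0 | apply sin_int_pos]; lra.
Qed.

Lemma sin_b_pos (n : nat) (x : R) : 0 < x < PI -> 0 < sin_b n x.
Proof.
  intros Hx. pose proof (sin_b_lower_neg n x Hx). pose proof (pos_INR n).
  pose proof (sin_b_lower n x ltac:(lra)).
  destruct (Rlt_or_le 0 (cos x)); nra.
Qed.

Lemma sin_b_ge_abs_cos (n : nat) (x : R) :
  0 <= x <= PI -> INR n * Rabs (cos x) <= sin_b n x.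
Proof.
  intros Hx. pose proof (pos_INR n) as Hn.
  assert (H1 : - INR n * cos x <= sin_b n x).
  { destruct (Req_dec x 0) as [-> | H0].
    { rewrite sin_b_0, cos_0. lra. }
    destruct (Req_dec x PI) as [-> | HP].
    { rewrite sin_b_PI, cos_PI. lra. }
    left. apply sin_b_lower_neg. lra. }
  pose proof (sin_b_lower n x Hx).
  unfold Rabs. destruct (Rcase_abs (cos x)); nra.
Qed.

Lemma sin_b_ge_linear (al be : R) (n : nat) (x : R) :
  0 < be ->
  (forall p w, (al * p + be * w) ^ 2 <= be * p ^ 2 + al * p * w + be * w ^ 2) ->
  (0 < n)%nat -> 0 <= x <= PI ->
  2 * al * sqrt (INR n) * sin x + (2 * be - 1) * INR n * cos x <= sin_b n x.
Proof.
  intros Hbe Hq Hn Hx. pose proof (pos_INR n) as HN.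
  assert (Hbe1 : be <= 1) by (specialize (Hq 0 1); nra).
  destruct (Req_dec x 0) as [-> | H0].
  { rewrite sin_b_0, cos_0, sin_0. nra. }
  destruct (Req_dec x PI) as [-> | HP].
  { rewrite sin_b_PI, cos_PI, sin_PI. nra. }
  rewrite sin_b_gt0 by lra.
  assert (HI : 0 < sin_int n x) by (apply sin_int_pos; lra).
  pose proof (linear_sin_int_le al be n x Hbe Hq Hn ltac:(lra)) as H.
  apply Rle_div_r in H; [|assumption]. lra.
Qed.

Lemma continuous_sin_b (n : nat) (x : R) :
  0 <= x <= PI -> continuous (sin_b n) x.
Proof.
  intros Hx. destruct (proj1 Hx) as [H0 | <-].
  - apply continuous_ext_loc
      with (fun u => 2 * (sin u ^ S n / sin_int n u) - INR n * cos u).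
    + apply (filter_imp (fun u => 0 < u)).
      * intros u Hu. symmetry. apply sin_b_gt0, Hu.
      * apply (open_gt 0 x H0).
    + apply (ex_derive_continuous
        (fun u => 2 * (sin u ^ S n / sin_int n u) - INR n * cos u)).
      assert (0 < sin_int n x) by (apply sin_int_pos; lra).
      auto_derive. repeat split; [apply ex_derive_sin_int | lra].
  - assert (HL : continuous (fun u => (INR n + 2) * cos u) 0)
      by (apply (ex_derive_continuous (fun u => (INR n + 2) * cos u));
          auto_derive; trivial).
    assert (HU : continuous (fun u => 2 * (INR n + 1) - INR n * cos u) 0)
      by (apply (ex_derive_continuous (fun u => 2 * (INR n + 1) - INR n * cos u));
          auto_derive; trivial).
    apply filterlim_locally. intros eps.
    pose proof (proj1 (filterlim_locally _ _) HL eps) as HL'.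
    pose proof (proj1 (filterlim_locally _ _) HU eps) as HU'.
    assert (HPI : locally 0 (fun u => u < PI)) by apply (open_lt PI 0 PI_RGT_0).
    generalize (filter_and _ _ (filter_and _ _ HL' HU') HPI).
    apply filter_imp. intros u [[H1 H2] H3].
    assert (H : (INR n + 2) * cos u <= sin_b n u
                <= 2 * (INR n + 1) - INR n * cos u).
    { destruct (Rle_or_lt 0 u) as [Hu | Hu].
      - split; [apply sin_b_lower | apply sin_b_upper]; lra.
      - pose proof (COS_bound u). pose proof (pos_INR n).
        unfold sin_b. destruct (Rle_dec u 0); [nra | lra]. }
    change (Rabs (sin_b n u - sin_b n 0) < eps).
    change (Rabs ((INR n + 2) * cos u - (INR n + 2) * cos 0) < eps) in H1.
    change (Rabs (2 * (INR n + 1) - INR n * cos u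
                  - (2 * (INR n + 1) - INR n * cos 0)) < eps) in H2.
    rewrite cos_0 in H1, H2. rewrite sin_b_0.
    apply Rabs_def2 in H1. apply Rabs_def2 in H2. apply Rabs_def1; lra.
Qed.

(** The second derivative of phi_n, continuously extended to 0 and PI. For n = 0
    the factor [INR n] makes it the constant 1/2, although [sin_b 0 PI = 0]. *)
Definition phi_dd (n : nat) (x : R) : R :=
  1 / 2 - INR n * (sin x ^ 2 + (INR n + 2) / 2 * cos x ^ 2) / sin_b n x ^ 2.

Lemma is_derive_b_fun (n : nat) (x : R) : 0 < x < PI ->
  is_derive (b_fun n) x
    (2 * (INR n * (cos x / sin x) * (sin x ^ n / sin_int n x)
          - (sin x ^ n / sin_int n x) ^ 2) + INR n / sin x ^ 2).
Proof.
  intros Hx.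
  assert (Hs : 0 < sin x) by (apply sin_gt_0; lra).
  assert (HI : 0 < sin_int n x) by (apply sin_int_pos; lra).
  unfold b_fun. auto_derive.
  - repeat split; try lra. apply ex_derive_sin_int.
  - rewrite Derive_sin_int.
    assert (Hpow : sin x ^ Init.Nat.pred n * INR n = INR n * (sin x ^ n / sin x)).
    { destruct n as [|n]; [simpl; ring|].
      change (Init.Nat.pred (S n)) with n. rewrite <- tech_pow_Rmult. field. lra. }
    replace (INR n * (1 * cos x) * sin x ^ Init.Nat.pred n)
      with (cos x * (sin x ^ Init.Nat.pred n * INR n)) by ring.
    replace (1 * cos x * (INR n * sin x ^ Init.Nat.pred n))
      with (cos x * (sin x ^ Init.Nat.pred n * INR n)) by ring.
    rewrite Hpow.
    assert (Hc2 : cos x ^ 2 = 1 - sin x ^ 2).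
    { pose proof (sin2_cos2 x) as H. unfold Rsqr in H. lra. }
    field_simplify; [|lra|lra]. rewrite ?Hc2. field. lra.
Qed.

(** Eliminating [sin_int] in favour of b_n turns b_n' into
    n / sin^2 + (n^2 cot^2 - b_n^2) / 2. *)
Lemma is_derive_inv_b (n : nat) (x : R) :
  0 < x < PI -> is_derive (fun u => 1 / b_fun n u) x (phi_dd n x).
Proof.
  intros Hx.
  assert (Hs : 0 < sin x) by (apply sin_gt_0; lra).
  pose proof (sin_b_pos n x Hx) as Hh.
  assert (Hb : b_fun n x <> 0).
  { rewrite sin_b_eq by assumption. apply Rgt_not_eq, Rdiv_lt_0_compat; assumption. }
  apply (is_derive_ext (fun u => / b_fun n u)).
  { intros u. unfold Rdiv. symmetry. apply Rmult_1_l. }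
  replace (phi_dd n x) with
    (- (2 * (INR n * (cos x / sin x) * (sin x ^ n / sin_int n x)
          - (sin x ^ n / sin_int n x) ^ 2) + INR n / sin x ^ 2) / b_fun n x ^ 2).
  { apply is_derive_inv; [apply is_derive_b_fun|]; assumption. }
  rewrite sin_b_eq by assumption. unfold phi_dd.
  assert (Ha : sin x ^ n / sin_int n x
               = (sin_b n x + INR n * cos x) / (2 * sin x)).
  { rewrite sin_b_gt0 by lra. rewrite <- tech_pow_Rmult. field.
    split; [|lra]. apply Rgt_not_eq, sin_int_pos; lra. }
  rewrite Ha.
  replace (INR n / sin x ^ 2) with (INR n * (sin x ^ 2 + cos x ^ 2) / sin x ^ 2).
  - field. lra.
  - replace (sin x ^ 2 + cos x ^ 2) with 1; [field; lra|].
    pose proof (sin2_cos2 x) as H. unfold Rsqr in H. lra.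
Qed.

Lemma continuous_phi_dd (n : nat) (x : R) :
  0 <= x <= PI -> continuous (phi_dd n) x.
Proof.
  intros Hx. destruct n as [|n].
  { apply (continuous_ext (fun _ => 1 / 2)).
    - intros u. unfold phi_dd. simpl INR. unfold Rdiv.
      rewrite !Rmult_0_l, Rminus_0_r. reflexivity.
    - apply continuous_const. }
  assert (Hh : sin_b (S n) x <> 0).
  { destruct (Req_dec x 0) as [-> | H0].
    { rewrite sin_b_0. pose proof (pos_INR (S n)). lra. }
    destruct (Req_dec x PI) as [-> | HP].
    { rewrite sin_b_PI. apply not_0_INR. lia. }
    apply Rgt_not_eq, sin_b_pos. lra. }
  unfold phi_dd. apply (continuous_minus (fun _ => 1 / 2)).
  { apply continuous_const. }
  apply (continuous_mult
    (fun u => INR (S n) * (sin u ^ 2 + (INR (S n) + 2) / 2 * cos u ^ 2))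
    (fun u => / sin_b (S n) u ^ 2)).
  - apply (ex_derive_continuous
      (fun u => INR (S n) * (sin u ^ 2 + (INR (S n) + 2) / 2 * cos u ^ 2))).
    auto_derive. trivial.
  - apply (continuous_comp (sin_b (S n)) (fun y => / y ^ 2)).
    + apply continuous_sin_b, Hx.
    + apply (ex_derive_continuous (fun y => / y ^ 2)).
      auto_derive. apply (pow_nonzero _ 2), Hh.
Qed.

Lemma is_second_derivative_phi_dd (n : nat) (f : R -> R) :
  is_phi n f -> is_second_derivative f (phi_dd n).
Proof.
  intros [_ [_ Hf]]. split; [|split].
  - intros x Hx. simpl.
    apply (is_derive_ext_loc (fun u => 1 / b_fun n u)).
    + assert (Hloc : locally x (fun u => 0 < u < PI)).
      { apply (filter_and (fun u => 0 < u) (fun u => u < PI));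
          [apply (open_gt 0) | apply (open_lt PI)]; lra. }
      revert Hloc. apply filter_imp. intros u Hu. symmetry.
      apply is_derive_unique, Hf, Hu.
    + apply is_derive_inv_b, Hx.
  - apply (filterlim_filter_le_1 (F := locally 0)); [apply filter_le_within|].
    apply continuous_phi_dd. pose proof PI_RGT_0. lra.
  - apply (filterlim_filter_le_1 (F := locally PI)); [apply filter_le_within|].
    apply continuous_phi_dd. pose proof PI_RGT_0. lra.
Qed.

Lemma phi_dd_has_min (n : nat) :
  exists m, is_min_on (fun x => 0 <= x <= PI) (phi_dd n) m.
Proof.
  destruct (continuity_ab_min (phi_dd n) 0 PI) as [x [Hmin Hx]].
  - pose proof PI_RGT_0. lra.
  - intros c Hc. apply continuity_pt_filterlim, continuous_phi_dd, Hc.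
  - exists (phi_dd n x). split; [exists x; auto | exact Hmin].
Qed.

(** Follows from [sin_b_ge_abs_cos]; useful where cot^2 is large against 1/n. *)
Lemma phi_dd_tail (n : nat) (x : R) : (0 < n)%nat -> 0 <= x <= PI -> cos x <> 0 ->
  - (1 / INR n) - sin x ^ 2 / (INR n * cos x ^ 2) <= phi_dd n x.
Proof.
  intros Hn Hx Hc. assert (HN : 0 < INR n) by (apply lt_0_INR; lia).
  pose proof (sin_b_ge_abs_cos n x Hx) as Hh.
  assert (Hc2 : 0 < cos x ^ 2) by nra.
  assert (Hh2 : INR n ^ 2 * cos x ^ 2 <= sin_b n x ^ 2).
  { rewrite <- (pow2_abs (cos x)), <- Rpow_mult_distr.
    apply pow_incr. split; [|exact Hh].
    apply Rmult_le_pos; [lra | apply Rabs_pos]. }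
  assert (0 < INR n ^ 2 * cos x ^ 2) by (apply Rmult_lt_0_compat; nra).
  unfold phi_dd.
  replace (- (1 / INR n) - sin x ^ 2 / (INR n * cos x ^ 2)) with
    (1 / 2 - INR n * (sin x ^ 2 + (INR n + 2) / 2 * cos x ^ 2)
              / (INR n ^ 2 * cos x ^ 2)) by (field; lra).
  apply Rplus_le_compat_l, Ropp_le_contravar, Rmult_le_compat_l.
  - apply Rmult_le_pos; [lra|]. nra.
  - apply Rinv_le_contravar; assumption.
Qed.

(** To be read with s = sin x, w = sqrt n * cos x and h = [sin_b n x / sqrt n].
    The constant 51/100 is 1/2 (1 + 2/n) at n = 100, and 21/22 is
    1/2 + 5/11. *)
Lemma quadratic_bound (s w h : R) :
  0 <= s -> Rabs w <= h -> 3 / 2 * s + 1 / 2 * w <= h -> 6 / 7 * s - 1 / 2 * w <= h ->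
  s ^ 2 + 51 / 100 * w ^ 2 <= 21 / 22 * h ^ 2.
Proof.
  intros Hs Hw H1 H2.
  assert (Hsq : forall y, 0 <= y -> y <= h -> y ^ 2 <= h ^ 2)
    by (intros; apply pow_incr; lra).
  unfold Rabs in Hw. destruct (Rcase_abs w) as [Hneg | Hpos].
  (* In each range of [w / s] one of the lower bounds for [h] suffices. *)
  - destruct (Rle_or_lt (1.6 * s) (- w)) as [Ht | Ht].
    { specialize (Hsq (- w) ltac:(lra) Hw). nra. }
    destruct (Rle_or_lt (- w) (s / 2)) as [Ht' | Ht'].
    { assert (0 <= s * (s / 2 + w)) by (apply Rmult_le_pos; lra).
      assert (0 <= (- w) * (s / 2 + w)) by (apply Rmult_le_pos; lra).
      specialize (Hsq (3 / 2 * s + 1 / 2 * w) ltac:(lra) H1). nra. }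
    assert (0 <= (- w - s / 2) * (1.6 * s + w)) by (apply Rmult_le_pos; lra).
    assert (0 <= (- w - s / 2) * s) by (apply Rmult_le_pos; lra).
    specialize (Hsq (6 / 7 * s - 1 / 2 * w) ltac:(lra) H2). nra.
  - destruct (Rle_or_lt (2 * s) w) as [Ht | Ht].
    { specialize (Hsq w ltac:(lra) Hw). nra. }
    specialize (Hsq (3 / 2 * s + 1 / 2 * w) ltac:(lra) H1). nra.
Qed.

Lemma phi_dd_lower (n : nat) (x : R) :
  (100 <= n)%nat -> 0 <= x <= PI -> - (5 / 11) <= phi_dd n x.
Proof.
  intros Hn Hx.
  assert (HN : 100 <= INR n) by (replace 100 with (INR 100) by (simpl; lra);
    apply le_INR, Hn).
  assert (Hr0 : 0 < sqrt (INR n)) by (apply sqrt_lt_R0; lra).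
  assert (Hr : sqrt (INR n) * sqrt (INR n) = INR n) by (apply sqrt_sqrt; lra).
  assert (Hs : 0 <= sin x) by (apply sin_ge_0; lra).
  pose proof (sin_b_ge_abs_cos n x Hx) as B0.
  pose proof (sin_b_ge_linear (3 / 4) (3 / 4) n x ltac:(lra)
    ltac:(intros p w; pose proof (pow2_ge_0 (p - w)); lra) ltac:(lia) Hx) as B1.
  pose proof (sin_b_ge_linear (3 / 7) (1 / 4) n x ltac:(lra)
    ltac:(intros p w; pose proof (pow2_ge_0 (w + 4 / 7 * p));
          pose proof (pow2_ge_0 p); lra) ltac:(lia) Hx) as B2.
  assert (Hh : 0 < sin_b n x).
  { destruct (Req_dec x 0) as [-> | H0]; [rewrite sin_b_0; lra|].
    destruct (Req_dec x PI) as [-> | HP]; [rewrite sin_b_PI; lra|].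
    apply sin_b_pos. lra. }
  set (r := sqrt (INR n)) in *.
  assert (Hq : sin x ^ 2 + 51 / 100 * (r * cos x) ^ 2
               <= 21 / 22 * (sin_b n x / r) ^ 2).
  { apply quadratic_bound.
    - exact Hs.
    - apply Rle_div_r; [exact Hr0|].
      rewrite Rabs_mult, (Rabs_pos_eq r) by lra. rewrite <- Hr in B0. lra.
    - apply Rle_div_r; [exact Hr0|]. rewrite <- Hr in B1. lra.
    - apply Rle_div_r; [exact Hr0|]. rewrite <- Hr in B2. lra. }
  unfold phi_dd.
  enough (INR n * (sin x ^ 2 + (INR n + 2) / 2 * cos x ^ 2) / sin_b n x ^ 2
          <= 21 / 22) by lra.
  apply Rle_div_l; [apply pow_lt, Hh|].
  replace (sin_b n x ^ 2) with (INR n * (sin_b n x / r) ^ 2)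
    by (rewrite <- Hr; field; lra).
  replace ((r * cos x) ^ 2) with (INR n * cos x ^ 2) in Hq
    by (rewrite <- Hr; ring).
  rewrite (Rmult_comm (21 / 22)), Rmult_assoc. apply Rmult_le_compat_l; [lra|].
  pose proof (pow2_ge_0 (cos x)). nra.
Qed.

(** * Wallis integrals *)

Lemma sin_int_rec (n : nat) :
  (INR n + 2) * sin_int (S (S n)) (PI / 2) = (INR n + 1) * sin_int n (PI / 2).
Proof.
  pose proof PI_RGT_0 as Hpi.
  pose (F := fun u => (INR n + 2) * sin_int (S (S n)) u
                      - (INR n + 1) * sin_int n u + sin u ^ S n * cos u).
  assert (HF : forall u, is_derive F u 0).
  { intros u. unfold F. auto_derive.
    - repeat split; apply ex_derive_sin_int.
    - rewrite !Derive_sin_int. change (Init.Nat.pred (S n)) with n.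
      change (match n with O => 1 | S _ => INR n + 1 end) with (INR (S n)).
      rewrite S_INR.
      pose proof (sin2_cos2 u) as H. unfold Rsqr in H.
      assert (Hc : cos u * cos u = 1 - sin u * sin u) by lra.
      replace (1 * cos u * ((INR n + 1) * sin u ^ n) * cos u) with
        ((INR n + 1) * sin u ^ n * (cos u * cos u)) by ring.
      rewrite Hc. simpl pow. ring. }
  assert (H1 : F 0 <= F (PI / 2))
    by (apply (le_of_deriv_nonneg F (fun _ => 0)); intros; auto; lra).
  assert (H2 : - F 0 <= - F (PI / 2)).
  { apply (le_of_deriv_nonneg (fun u => - F u) (fun _ => 0)); intros; try lra.
    replace 0 with (- 0) by ring. apply (is_derive_opp F), HF. }
  assert (H0 : F 0 = 0).
  { unfold F. rewrite !sin_int_0, sin_0, pow_i by lia. ring. }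
  assert (H3 : F (PI / 2) = (INR n + 2) * sin_int (S (S n)) (PI / 2)
                      - (INR n + 1) * sin_int n (PI / 2))
    by (unfold F; rewrite cos_PI2; ring).
  lra.
Qed.

Lemma wallis_product (n : nat) :
  (INR n + 1) * (sin_int n (PI / 2) * sin_int (S n) (PI / 2)) = PI / 2.
Proof.
  induction n as [|n IH].
  - assert (E0 : sin_int 0 (PI / 2) = PI / 2).
    { unfold sin_int. simpl. rewrite RInt_const.
      change ((PI / 2 - 0) * 1 = PI / 2). ring. }
    assert (E1 : sin_int 1 (PI / 2) = 1).
    { apply is_RInt_unique.
      replace 1 with (minus (- cos (PI / 2)) (- cos 0))
        by (rewrite cos_PI2, cos_0; unfold minus, plus, opp; simpl; ring).
      apply (is_RInt_derive (fun u => - cos u)).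
      - intros u _. auto_derive; trivial. ring.
      - intros u _. apply continuous_sin_pow. }
    rewrite E0, E1. simpl. ring.
  - etransitivity; [|exact IH]. rewrite S_INR.
    replace (INR n + 1 + 1) with (INR n + 2) by ring.
    replace ((INR n + 2) * (sin_int (S n) (PI / 2) * sin_int (S (S n)) (PI / 2)))
      with (sin_int (S n) (PI / 2) * ((INR n + 2) * sin_int (S (S n)) (PI / 2)))
      by ring.
    rewrite sin_int_rec. ring.
Qed.

Lemma sin_int_antitone (n : nat) :
  sin_int (S n) (PI / 2) <= sin_int n (PI / 2).
Proof.
  pose proof PI_RGT_0 as Hpi.
  enough (sin_int n 0 - sin_int (S n) 0
          <= sin_int n (PI / 2) - sin_int (S n) (PI / 2)) as H
    by (rewrite !sin_int_0 in H; lra).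
  apply (le_of_deriv_nonneg (fun u => sin_int n u - sin_int (S n) u)
           (fun u => sin u ^ n - sin u ^ S n)); [lra| |].
  - intros u _. apply (is_derive_minus (sin_int n) (sin_int (S n)));
      apply is_derive_sin_int.
  - intros u Hu. rewrite <- tech_pow_Rmult.
    assert (0 <= sin u) by (apply sin_ge_0; lra).
    pose proof (pow_le (sin u) n H). pose proof (SIN_bound u). nra.
Qed.

(** The product formula and monotonicity squeeze n W_n^2 between
    (PI/2) n/(n+1) and PI/2, where W_n is the integral over [0, PI/2]. *)
Lemma wallis_limit :
  is_lim_seq (fun n => sqrt (INR n) * sin_int n (PI / 2)) (sqrt (PI / 2)).
Proof.
  pose proof PI_RGT_0 as Hpi.
  apply is_lim_seq_ext with (fun n => sqrt (INR n * sin_int n (PI / 2) ^ 2)).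
  { intros n. rewrite sqrt_mult.
    - rewrite sqrt_pow2; [reflexivity|]. apply sin_int_nonneg. lra.
    - apply pos_INR.
    - apply pow2_ge_0. }
  apply (is_lim_seq_continuous sqrt _ (PI / 2)).
  { apply continuity_pt_sqrt. lra. }
  apply is_lim_seq_incr_1.
  apply is_lim_seq_le_le with
    (fun n => PI / 2 - PI / 2 * / (INR n + 2)) (fun _ => PI / 2).
  - intros n.
    pose proof (sin_int_antitone n) as D1. pose proof (sin_int_antitone (S n)) as D2.
    pose proof (wallis_product n) as P1. pose proof (wallis_product (S n)) as P2.
    assert (W : 0 < sin_int (S n) (PI / 2)) by (apply sin_int_pos; lra).
    pose proof (pos_INR n). rewrite S_INR in *.
    replace (INR n + 1 + 1) with (INR n + 2) in P2 by ring.
    split.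
    + replace (PI / 2 - PI / 2 * / (INR n + 2))
        with ((INR n + 1) * (PI / 2 / (INR n + 2))) by (field; lra).
      apply Rmult_le_compat_l; [lra|].
      apply Rle_div_l; [lra|].
      apply Rle_trans with
        (sin_int (S n) (PI / 2) * sin_int (S (S n)) (PI / 2) * (INR n + 2)); [lra|].
      apply Rmult_le_compat_r; [lra|]. nra.
    + eapply Rle_trans; [|apply Req_le, P1]. apply Rmult_le_compat_l; [lra|]. nra.
  - replace (Finite (PI / 2)) with (Finite (PI / 2 - PI / 2 * 0)) by (f_equal; ring).
    apply is_lim_seq_minus'; [apply is_lim_seq_const|].
    apply is_lim_seq_mult'; [apply is_lim_seq_const|].
    apply is_lim_seq_ext with (fun n => / INR (S (S n))).
    { intros n. f_equal. rewrite !S_INR. ring. }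
    apply (is_lim_seq_incr_1 (fun n => / INR (S n))).
    apply (is_lim_seq_incr_1 (fun n => / INR n)).
    replace (Finite 0) with (Rbar_inv p_infty) by reflexivity.
    apply is_lim_seq_inv; [apply is_lim_seq_INR | discriminate].
  - apply is_lim_seq_const.
Qed.

(** * Rescaling around PI/2 *)

Definition gauss (t : R) : R := exp (- (t ^ 2 / 2)).

(** For n > 0, the point x of (0, PI) with cot x = - t / sqrt n. *)
Definition rescale (n : nat) (t : R) : R := PI / 2 + atan (t / sqrt (INR n)).

(** sin^n in the rescaled variable; it equals (1 + t^2/n)^(-n/2). *)
Definition sin_scaled (n : nat) (t : R) : R := sin (rescale n t) ^ n.

(** The factor sqrt n makes the integral converge to a nonzero limit. *)
Definition int_scaled (n : nat) (t : R) : R :=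
  sqrt (INR n) * sin_int n (rescale n t).

Lemma sqrt_INR_pos (n : nat) : (0 < n)%nat -> 0 < sqrt (INR n).
Proof. intros Hn. apply sqrt_lt_R0, lt_0_INR, Hn. Qed.

Lemma rescale_bounds (n : nat) (t : R) : 0 < rescale n t < PI.
Proof. unfold rescale. pose proof (atan_bound (t / sqrt (INR n))). lra. Qed.

Lemma sin_rescale_pos (n : nat) (t : R) : 0 < sin (rescale n t).
Proof. pose proof (rescale_bounds n t). apply sin_gt_0; lra. Qed.

Lemma cos_rescale (n : nat) (t : R) : (0 < n)%nat ->
  sqrt (INR n) * cos (rescale n t) = - t * sin (rescale n t).
Proof.
  intros Hn. pose proof (sqrt_INR_pos n Hn).
  unfold rescale. rewrite <- cos_sin.
  replace (cos (PI / 2 + _)) with (- sin (atan (t / sqrt (INR n))))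
    by (rewrite sin_cos; ring).
  pose proof (atan_bound (t / sqrt (INR n))) as Hb.
  assert (Hc : 0 < cos (atan (t / sqrt (INR n)))) by (apply cos_gt_0; lra).
  assert (E : sin (atan (t / sqrt (INR n)))
              = t / sqrt (INR n) * cos (atan (t / sqrt (INR n)))).
  { rewrite <- (tan_atan (t / sqrt (INR n))) at 2. unfold tan. field. lra. }
  rewrite E. field. lra.
Qed.

Lemma sin_rescale_sq (n : nat) (t : R) : (0 < n)%nat ->
  sin (rescale n t) ^ 2 = / (1 + t ^ 2 / INR n).
Proof.
  intros Hn. pose proof (cos_rescale n t Hn) as Hc.
  assert (HN : 0 < INR n) by (apply lt_0_INR, Hn).
  assert (Hr : sqrt (INR n) * sqrt (INR n) = INR n) by (apply sqrt_sqrt; lra).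
  pose proof (sin2_cos2 (rescale n t)) as Ht. unfold Rsqr in Ht.
  assert (E : INR n * cos (rescale n t) ^ 2 = t ^ 2 * sin (rescale n t) ^ 2).
  { replace (t ^ 2 * sin (rescale n t) ^ 2) with ((- t * sin (rescale n t)) ^ 2) by ring.
    rewrite <- Hc, <- Hr at 1. ring. }
  assert (Hpos : 0 < INR n + t ^ 2) by (pose proof (pow2_ge_0 t); lra).
  replace (/ (1 + t ^ 2 / INR n)) with (INR n / (INR n + t ^ 2)) by (field; lra).
  apply Rmult_eq_reg_r with (INR n + t ^ 2); [|lra].
  replace (INR n / (INR n + t ^ 2) * (INR n + t ^ 2)) with (INR n) by (field; lra).
  replace (cos (rescale n t) ^ 2) with (1 - sin (rescale n t) ^ 2) in E by lra.
  lra.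
Qed.

Lemma rescale_surj (n : nat) (x : R) : (0 < n)%nat -> 0 < x < PI ->
  rescale n (- (sqrt (INR n) * cos x / sin x)) = x.
Proof.
  intros Hn Hx. pose proof (sqrt_INR_pos n Hn).
  assert (0 < sin x) by (apply sin_gt_0; lra).
  unfold rescale.
  replace (- (sqrt (INR n) * cos x / sin x) / sqrt (INR n)) with (tan (x - PI / 2)).
  - rewrite atan_tan; lra.
  - unfold tan. rewrite sin_minus, cos_minus, sin_PI2, cos_PI2. field.
    split; lra.
Qed.

Lemma exp_pow (x : R) (n : nat) : exp x ^ n = exp (INR n * x).
Proof.
  induction n as [|n IH].
  - simpl. rewrite Rmult_0_l, exp_0. reflexivity.
  - rewrite <- tech_pow_Rmult, IH, <- exp_plus, S_INR. f_equal. ring.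
Qed.

Lemma exp_nondecreasing (x y : R) : x <= y -> exp x <= exp y.
Proof.
  intros [H | ->]; [left; apply exp_increasing, H | lra].
Qed.

Lemma sin_scaled_pos (n : nat) (t : R) : 0 < sin_scaled n t.
Proof. apply pow_lt, sin_rescale_pos. Qed.

Lemma sin_scaled_le_1 (n : nat) (t : R) : sin_scaled n t <= 1.
Proof.
  unfold sin_scaled. rewrite <- (pow1 n). apply pow_incr.
  pose proof (sin_rescale_pos n t). pose proof (SIN_bound (rescale n t)). lra.
Qed.

Lemma sin_scaled_sq (n : nat) (t : R) : (0 < n)%nat ->
  sin_scaled n t ^ 2 = (/ (1 + t ^ 2 / INR n)) ^ n.
Proof.
  intros Hn. unfold sin_scaled.
  rewrite <- (sin_rescale_sq n t Hn), <- !pow_mult. f_equal. lia.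
Qed.

Lemma div_INR_nonneg (n : nat) (y : R) : (0 < n)%nat -> 0 <= y -> 0 <= y / INR n.
Proof. intros Hn Hy. apply Rle_div_r; [apply lt_0_INR, Hn | lra]. Qed.

Lemma gauss_le_sin_scaled (n : nat) (t : R) : (0 < n)%nat ->
  gauss t <= sin_scaled n t.
Proof.
  intros Hn. assert (HN : 0 < INR n) by (apply lt_0_INR, Hn).
  pose proof (sin_scaled_pos n t).
  pose proof (div_INR_nonneg n _ Hn (pow2_ge_0 t)) as Hv.
  enough (gauss t ^ 2 <= sin_scaled n t ^ 2) by
    (apply Rnot_lt_le; intros ?; nra).
  rewrite (sin_scaled_sq n t Hn). unfold gauss. rewrite exp_pow.
  replace (INR 2 * - (t ^ 2 / 2)) with (INR n * (- (t ^ 2 / INR n)))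
    by (simpl; field; lra).
  rewrite <- exp_pow. apply pow_incr. split; [left; apply exp_pos|].
  rewrite exp_Ropp. apply Rinv_le_contravar; [lra|]. apply exp_ineq1_le.
Qed.

Lemma sin_scaled_le_gauss (n : nat) (t : R) : (0 < n)%nat ->
  sin_scaled n t <= gauss t + t ^ 4 / (2 * INR n).
Proof.
  intros Hn. assert (HN : 0 < INR n) by (apply lt_0_INR, Hn).
  pose proof (sin_scaled_pos n t) as Hpos.
  pose proof (sin_scaled_le_1 n t) as H1.
  pose proof (div_INR_nonneg n _ Hn (pow2_ge_0 t)) as Hv.
  set (d := t ^ 4 / (2 * INR n)).
  assert (Hd : 0 <= d).
  { replace d with (t ^ 2 * (t ^ 2 / INR n) / 2) by (unfold d; field; lra).
    pose proof (pow2_ge_0 t). nra. }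
  assert (Hsq : sin_scaled n t ^ 2 <= (gauss t * exp d) ^ 2).
  { rewrite (sin_scaled_sq n t Hn). unfold gauss. rewrite <- exp_plus, exp_pow.
    apply Rle_trans with (exp (INR n * (/ (1 + t ^ 2 / INR n) - 1))).
    (* 1/(1+v) <= exp (1/(1+v) - 1) and 1/(1+v) - 1 <= v^2 - v, for v = t^2/n. *)
    - rewrite <- exp_pow. apply pow_incr. split.
      + left. apply Rinv_0_lt_compat. lra.
      + pose proof (exp_ineq1_le (/ (1 + t ^ 2 / INR n) - 1)). lra.
    - apply exp_nondecreasing.
      replace (INR 2 * (- (t ^ 2 / 2) + d)) with
        (INR n * ((t ^ 2 / INR n) ^ 2 - t ^ 2 / INR n))
        by (unfold d; simpl INR; field; lra).
      apply Rmult_le_compat_l; [lra|].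
      set (v := t ^ 2 / INR n) in *.
      apply Rmult_le_reg_r with (1 + v); [lra|].
      rewrite Rmult_minus_distr_r, Rinv_l by lra. nra. }
  assert (Hg : 0 < gauss t * exp d) by (apply Rmult_lt_0_compat; apply exp_pos).
  assert (Hle : sin_scaled n t <= gauss t * exp d)
    by (apply Rnot_lt_le; intros ?; nra).
  assert (Hm : sin_scaled n t * exp (- d) <= gauss t).
  { rewrite exp_Ropp. apply Rmult_le_reg_r with (exp d); [apply exp_pos|].
    rewrite Rmult_assoc, Rinv_l by apply Rgt_not_eq, exp_pos. lra. }
  pose proof (exp_ineq1_le (- d)). nra.
Qed.

Lemma is_derive_int_scaled (n : nat) (t : R) : (0 < n)%nat ->
  is_derive (int_scaled n) t (sin_scaled n t / (1 + t ^ 2 / INR n)).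
Proof.
  intros Hn. pose proof (sqrt_INR_pos n Hn) as Hr.
  assert (HN : 0 < INR n) by (apply lt_0_INR, Hn).
  assert (Hrr : sqrt (INR n) * sqrt (INR n) = INR n) by (apply sqrt_sqrt; lra).
  assert (Hx : is_derive (rescale n) t
            (/ (1 + (t / sqrt (INR n)) ^ 2) * / sqrt (INR n))).
  { unfold rescale.
    apply (is_derive_ext (fun u => atan (u / sqrt (INR n)) + PI / 2)).
    { intros u. apply Rplus_comm. }
    replace (/ (1 + (t / sqrt (INR n)) ^ 2) * / sqrt (INR n)) with
      (/ (1 + (t / sqrt (INR n)) ^ 2) * / sqrt (INR n) + 0) by ring.
    apply (is_derive_plus (fun u => atan (u / sqrt (INR n))) (fun _ => PI / 2));
      [|exact (is_derive_const (PI / 2) t)].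
    rewrite Rmult_comm.
    apply (is_derive_comp atan (fun u => u / sqrt (INR n))).
    - apply is_derive_Reals, derivable_pt_lim_atan.
    - auto_derive; [trivial | field; lra]. }
  pose proof (is_derive_comp (sin_int n) (rescale n) t _ _
    (is_derive_sin_int n (rescale n t)) Hx) as Hc.
  pose proof (is_derive_scal _ t (sqrt (INR n)) _ Hc) as Hs.
  unfold int_scaled.
  replace (sin_scaled n t / (1 + t ^ 2 / INR n)) with
    (sqrt (INR n) * scal (/ (1 + (t / sqrt (INR n)) ^ 2) * / sqrt (INR n))
       (sin (rescale n t) ^ n)); [exact Hs|].
  change (sqrt (INR n) * ((/ (1 + (t / sqrt (INR n)) ^ 2) * / sqrt (INR n)) *
       (sin (rescale n t) ^ n)) = sin_scaled n t / (1 + t ^ 2 / INR n)).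
  unfold sin_scaled.
  set (r := sqrt (INR n)) in *.
  replace ((t / r) ^ 2) with (t ^ 2 / INR n) by (rewrite <- Hrr; field; lra).
  pose proof (div_INR_nonneg n _ Hn (pow2_ge_0 t)).
  field. repeat split; try lra. pose proof (pow2_ge_0 t). lra.
Qed.

Lemma phi_dd_rescale (n : nat) (t : R) : (0 < n)%nat ->
  phi_dd n (rescale n t)
  = 1 / 2 - (1 + t ^ 2 / 2 + t ^ 2 / INR n)
            * (/ (t + 2 * (sin_scaled n t * / int_scaled n t))) ^ 2.
Proof.
  intros Hn. pose proof (rescale_bounds n t) as Hb.
  pose proof (sin_b_pos n _ Hb) as Hpos.
  unfold phi_dd. rewrite sin_b_gt0 in * by lra.
  pose proof (sin_rescale_pos n t) as Hs.
  pose proof (cos_rescale n t Hn) as Hc.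
  assert (HI : 0 < sin_int n (rescale n t)) by (apply sin_int_pos; lra).
  assert (HN : 0 < INR n) by (apply lt_0_INR, Hn).
  pose proof (sqrt_INR_pos n Hn) as Hr.
  assert (Hrr : sqrt (INR n) * sqrt (INR n) = INR n) by (apply sqrt_sqrt; lra).
  unfold int_scaled, sin_scaled.
  rewrite <- (tech_pow_Rmult (sin (rescale n t)) n) in *.
  set (s := sin (rescale n t)) in *. set (r := sqrt (INR n)) in *.
  replace (cos (rescale n t)) with (- t * s / r) in *
    by (rewrite <- Hc; field; lra).
  set (I := sin_int n (rescale n t)) in *. set (q := s ^ n) in *.
  rewrite <- Hrr in *.
  assert (E : 2 * (s * q / I) - r * r * (- t * s / r)
              = s * r * (t + 2 * (q * / (r * I)))) by (field; lra).
  rewrite E in *.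
  assert (HB : t + 2 * (q * / (r * I)) <> 0).
  { intros H0. rewrite H0 in Hpos. lra. }
  set (b := t + 2 * (q * / (r * I))) in *. field. repeat split; lra.
Qed.

(** * Operations on uniformly convergent sequences *)

Lemma CVU_of_rate (c : R) (r : posreal) (f : nat -> R -> R) (g : R -> R) (e : nat -> R) :
  is_lim_seq e 0 ->
  (forall n y, (0 < n)%nat -> Boule c r y -> Rabs (g y - f n y) <= e n) ->
  CVU f g c r.
Proof.
  intros He Hfg eps Heps.
  apply is_lim_seq_spec in He. destruct (He (mkposreal eps Heps)) as [N HN].
  exists (S N). intros n y Hn Hy. apply Rle_lt_trans with (e n).
  - apply Hfg; [lia | assumption].
  - specialize (HN n ltac:(lia)). simpl in HN. rewrite Rminus_0_r in HN.
    apply Rabs_def2 in HN. lra.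
Qed.

Lemma CVU_ext_eventually (c : R) (r : posreal) (f1 f2 : nat -> R -> R) (g : R -> R) :
  (forall n y, (0 < n)%nat -> f1 n y = f2 n y) -> CVU f1 g c r -> CVU f2 g c r.
Proof.
  intros E H eps Heps. destruct (H eps Heps) as [N HN].
  exists (S N). intros n y Hn Hy. rewrite <- E by lia. apply HN; [lia | assumption].
Qed.

Lemma CVU_const (c : R) (r : posreal) (g : R -> R) : CVU (fun _ => g) g c r.
Proof.
  intros eps Heps. exists 0%nat. intros n y _ _.
  rewrite Rminus_diag, Rabs_R0. exact Heps.
Qed.

Lemma CVU_plus (c : R) (r : posreal) (f1 f2 : nat -> R -> R) (g1 g2 : R -> R) :
  CVU f1 g1 c r -> CVU f2 g2 c r ->
  CVU (fun n y => f1 n y + f2 n y) (fun y => g1 y + g2 y) c r.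
Proof.
  intros H1 H2 eps Heps.
  destruct (H1 (eps / 2) ltac:(lra)) as [N1 HN1].
  destruct (H2 (eps / 2) ltac:(lra)) as [N2 HN2].
  exists (max N1 N2). intros n y Hn Hy.
  specialize (HN1 n y ltac:(lia) Hy). specialize (HN2 n y ltac:(lia) Hy).
  apply Rabs_def2 in HN1. apply Rabs_def2 in HN2. apply Rabs_def1; lra.
Qed.

Lemma CVU_mult (c : R) (r : posreal) (f1 f2 : nat -> R -> R) (g1 g2 : R -> R) (M : R) :
  (forall y, Boule c r y -> Rabs (g1 y) <= M) ->
  (forall y, Boule c r y -> Rabs (g2 y) <= M) ->
  CVU f1 g1 c r -> CVU f2 g2 c r ->
  CVU (fun n y => f1 n y * f2 n y) (fun y => g1 y * g2 y) c r.
Proof.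
  intros B1 B2 H1 H2 eps Heps.
  pose (K := Rabs M + 1).
  assert (HK : 1 <= K) by (unfold K; pose proof (Rabs_pos M); lra).
  assert (He : 0 < eps / (2 * K)) by (apply Rdiv_lt_0_compat; lra).
  destruct (H1 (eps / (2 * K)) He) as [N1 HN1].
  destruct (H2 (Rmin 1 (eps / (2 * K)))) as [N2 HN2];
    [apply Rmin_glb_lt; lra|].
  exists (max N1 N2). intros n y Hn Hy.
  specialize (HN1 n y ltac:(lia) Hy). specialize (HN2 n y ltac:(lia) Hy).
  specialize (B1 y Hy). specialize (B2 y Hy).
  pose proof (Rle_abs M).
  pose proof (Rmin_l 1 (eps / (2 * K))). pose proof (Rmin_r 1 (eps / (2 * K))).
  set (a1 := g1 y) in *. set (a2 := g2 y) in *.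
  set (b1 := f1 n y) in *. set (b2 := f2 n y) in *.
  assert (Hb2 : Rabs b2 <= K).
  { replace b2 with (a2 + - (a2 - b2)) by ring.
    eapply Rle_trans; [apply Rabs_triang|]. rewrite Rabs_Ropp. unfold K. lra. }
  replace (a1 * a2 - b1 * b2) with ((a1 - b1) * b2 + a1 * (a2 - b2)) by ring.
  eapply Rle_lt_trans; [apply Rabs_triang|]. rewrite !Rabs_mult.
  replace eps with (eps / (2 * K) * K + K * (eps / (2 * K))) by (field; lra).
  assert (Rabs (a1 - b1) * Rabs b2 <= Rabs (a1 - b1) * K)
    by (apply Rmult_le_compat_l; [apply Rabs_pos | assumption]).
  assert (Rabs (a1 - b1) * K < eps / (2 * K) * K)
    by (apply Rmult_lt_compat_r; lra).
  assert (Rabs a1 * Rabs (a2 - b2) <= K * (eps / (2 * K)))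
    by (apply Rmult_le_compat; try apply Rabs_pos; unfold K in *; lra).
  lra.
Qed.

Lemma CVU_lower_bound (c : R) (r : posreal) (f : nat -> R -> R) (g : R -> R) (d : R) :
  (forall n y, (0 < n)%nat -> Boule c r y -> d <= f n y) ->
  CVU f g c r -> forall y, Boule c r y -> d <= g y.
Proof.
  intros Hf H y Hy. apply le_epsilon. intros eps Heps.
  destruct (H eps Heps) as [N HN].
  specialize (HN (S N) y ltac:(lia) Hy).
  specialize (Hf (S N) y ltac:(lia) Hy). apply Rabs_def2 in HN. lra.
Qed.

Lemma CVU_inv (c : R) (r : posreal) (f : nat -> R -> R) (g : R -> R) (d : R) :
  0 < d ->
  (forall n y, (0 < n)%nat -> Boule c r y -> d <= f n y) ->
  CVU f g c r -> CVU (fun n y => / f n y) (fun y => / g y) c r.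
Proof.
  intros Hd Hf H eps Heps.
  pose proof (CVU_lower_bound c r f g d Hf H) as Hg.
  assert (He : 0 < eps * (d * d)) by (repeat apply Rmult_lt_0_compat; assumption).
  destruct (H _ He) as [N HN].
  exists (S N). intros n y Hn Hy.
  specialize (HN n y ltac:(lia) Hy). specialize (Hf n y ltac:(lia) Hy).
  specialize (Hg y Hy).
  set (a := g y) in *. set (b := f n y) in *.
  assert (Hab : d * d <= a * b) by nra.
  assert (Hdd : 0 < d * d) by nra.
  replace (/ a - / b) with (- (a - b) / (a * b)) by (field; lra).
  unfold Rdiv. rewrite Rabs_mult, Rabs_Ropp.
  rewrite (Rabs_pos_eq (/ (a * b)))
    by (left; apply Rinv_0_lt_compat; lra).
  change (Rabs (a - b) / (a * b) < eps).
  apply Rlt_div_l; [lra|].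
  apply Rlt_le_trans with (eps * (d * d)); [assumption|].
  apply Rmult_le_compat_l; lra.
Qed.

(** * Uniform convergence in the rescaled variable *)

(** The limit of [int_scaled]: the integral of [gauss] from minus infinity to t,
    with the half-line integral replaced by its value sqrt (PI/2). *)
Definition gauss_int (t : R) : R := sqrt (PI / 2) + RInt gauss 0 t.

Lemma is_derive_gauss_int (t : R) : is_derive gauss_int t (gauss t).
Proof.
  assert (Hc : forall u, continuous gauss u).
  { intros u. apply (ex_derive_continuous gauss). unfold gauss. auto_derive. trivial. }
  unfold gauss_int.
  replace (gauss t) with (0 + gauss t) by ring.
  apply (is_derive_plus (fun _ => sqrt (PI / 2)) (RInt gauss 0)).
  - exact (is_derive_const (sqrt (PI / 2)) t).
  - apply (is_derive_RInt gauss (RInt gauss 0) 0); [|apply Hc].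
    apply filter_forall. intro y. apply (@RInt_correct R_CompleteNormedModule).
    apply (@ex_RInt_continuous R_CompleteNormedModule). intros z _. apply Hc.
Qed.

Lemma gauss_int_0 : gauss_int 0 = sqrt (PI / 2).
Proof.
  unfold gauss_int. rewrite RInt_point. apply Rplus_0_r.
Qed.

Lemma gauss_pos (t : R) : 0 < gauss t.
Proof. apply exp_pos. Qed.

Lemma gauss_le_1 (t : R) : gauss t <= 1.
Proof.
  rewrite <- exp_0. apply exp_nondecreasing. pose proof (pow2_ge_0 t). lra.
Qed.

(** The radius of the ball |t| < 4 on which uniform convergence is proved. *)
Definition window : posreal := mkposreal 4 ltac:(lra).

Lemma in_window (y : R) : Boule 0 window y <-> -4 < y < 4.
Proof.
  unfold Boule, window. simpl. rewrite Rminus_0_r. split.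
  - intros H. apply Rabs_def2 in H. lra.
  - intros H. apply Rabs_def1; lra.
Qed.

Lemma is_lim_seq_div_INR (C : R) : is_lim_seq (fun n => C / INR n) 0.
Proof.
  replace (Finite 0) with (Finite (C * 0)) by (f_equal; ring).
  apply is_lim_seq_mult'; [apply is_lim_seq_const|].
  replace (Finite 0) with (Rbar_inv p_infty) by reflexivity.
  apply is_lim_seq_inv; [apply is_lim_seq_INR | discriminate].
Qed.

Lemma sin_scaled_dist (n : nat) (t : R) : (0 < n)%nat -> -4 < t < 4 ->
  Rabs (gauss t - sin_scaled n t) <= 128 / INR n.
Proof.
  intros Hn Ht. assert (HN : 0 < INR n) by (apply lt_0_INR, Hn).
  pose proof (gauss_le_sin_scaled n t Hn). pose proof (sin_scaled_le_gauss n t Hn).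
  assert (t ^ 4 / (2 * INR n) <= 128 / INR n).
  { replace (128 / INR n) with (256 / (2 * INR n)) by (field; lra).
    apply Rmult_le_compat_r; [left; apply Rinv_0_lt_compat; lra|].
    assert (0 <= t ^ 2 <= 16) by nra. nra. }
  apply Rabs_le. lra.
Qed.

Lemma CVU_sin_scaled : CVU sin_scaled gauss 0 window.
Proof.
  apply CVU_of_rate with (fun n => 128 / INR n); [apply is_lim_seq_div_INR|].
  intros n y Hn Hy. apply sin_scaled_dist; [exact Hn | apply in_window, Hy].
Qed.

Lemma int_scaled_0 (n : nat) :
  int_scaled n 0 = sqrt (INR n) * sin_int n (PI / 2).
Proof.
  unfold int_scaled, rescale. rewrite Rdiv_0_l, atan_0, Rplus_0_r. reflexivity.
Qed.

Lemma Rabs_increment_le (F dF : R -> R) (K t : R) :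
  (forall u, is_derive F u (dF u)) ->
  (forall u, Rmin 0 t <= u <= Rmax 0 t -> Rabs (dF u) <= K) ->
  Rabs (F t - F 0) <= K * Rabs t.
Proof.
  intros HF HK. destruct (MVT_gen F 0 t dF) as [xi [Hxi E]].
  - intros u _. apply HF.
  - intros u _. apply derivable_continuous_pt. exists (dF u).
    apply is_derive_Reals, HF.
  - rewrite E, Rminus_0_r, Rabs_mult. apply Rmult_le_compat_r; [apply Rabs_pos|].
    apply HK, Hxi.
Qed.

Lemma CVU_int_scaled : CVU int_scaled gauss_int 0 window.
Proof.
  apply CVU_of_rate with (fun n =>
    Rabs (sqrt (INR n) * sin_int n (PI / 2) - sqrt (PI / 2)) + 576 / INR n).
  { replace (Finite 0) with (Finite (0 + 0)) by (f_equal; ring).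
    apply is_lim_seq_plus'; [|apply is_lim_seq_div_INR].
    rewrite <- Rabs_R0. apply (is_lim_seq_abs _ 0).
    replace (Finite 0) with (Finite (sqrt (PI / 2) - sqrt (PI / 2)))
      by (f_equal; ring).
    apply is_lim_seq_minus'; [apply wallis_limit | apply is_lim_seq_const]. }
  intros n t Hn Ht. apply in_window in Ht.
  assert (HN : 0 < INR n) by (apply lt_0_INR, Hn).
  assert (H : Rabs ((gauss_int t - int_scaled n t)
                    - (gauss_int 0 - int_scaled n 0)) <= 144 / INR n * Rabs t).
  { apply (Rabs_increment_le (fun u => gauss_int u - int_scaled n u)
      (fun u => gauss u - sin_scaled n u / (1 + u ^ 2 / INR n))).
    - intros u. apply (is_derive_minus gauss_int (int_scaled n)).
      + apply is_derive_gauss_int.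
      + apply is_derive_int_scaled, Hn.
    - intros u Hu.
      assert (Hu4 : -4 < u < 4).
      { unfold Rmin, Rmax in Hu. destruct (Rle_dec 0 t); lra. }
      pose proof (sin_scaled_dist n u Hn Hu4) as Hd.
      pose proof (sin_scaled_pos n u). pose proof (sin_scaled_le_1 n u).
      assert (Hv : 0 <= u ^ 2 / INR n <= 16 / INR n).
      { split; [apply div_INR_nonneg; [exact Hn | apply pow2_ge_0]|].
        apply Rmult_le_compat_r; [left; apply Rinv_0_lt_compat; lra | nra]. }
      set (v := u ^ 2 / INR n) in *.
      replace (gauss u - sin_scaled n u / (1 + v)) with
        ((gauss u - sin_scaled n u) + sin_scaled n u * (v / (1 + v)))
        by (field; lra).
      eapply Rle_trans; [apply Rabs_triang|].
      assert (Hv1 : 0 <= v / (1 + v) <= v).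
      { split; [apply Rle_div_r; lra | apply Rle_div_l; nra]. }
      rewrite (Rabs_pos_eq (sin_scaled n u * (v / (1 + v))))
        by (apply Rmult_le_pos; lra).
      replace (144 / INR n) with (128 / INR n + 16 / INR n) by (field; lra).
      apply Rplus_le_compat; [exact Hd|]. nra. }
  rewrite gauss_int_0, int_scaled_0 in H.
  assert (Ht4 : 144 / INR n * Rabs t <= 576 / INR n).
  { replace (576 / INR n) with (144 / INR n * 4) by (field; lra).
    apply Rmult_le_compat_l; [|apply Rabs_le; lra].
    left. apply Rdiv_lt_0_compat; lra. }
  rewrite Rabs_minus_sym.
  rewrite (Rabs_minus_sym (sqrt (INR n) * _)).
  replace (int_scaled n t - gauss_int t) with
    (- (gauss_int t - int_scaled n t -
        (sqrt (PI / 2) - sqrt (INR n) * sin_int n (PI / 2)))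
     + - (sqrt (PI / 2) - sqrt (INR n) * sin_int n (PI / 2))) by ring.
  eapply Rle_trans; [apply Rabs_triang|]. rewrite !Rabs_Ropp. lra.
Qed.

(** Uniform positivity comes from the part of the integral over [-5, t], which
    has length at least 1. *)
Lemma int_scaled_lower (n : nat) (t : R) : (0 < n)%nat -> -4 < t < 4 ->
  gauss 5 / 26 <= int_scaled n t.
Proof.
  intros Hn Ht. assert (HN : 1 <= INR n) by (apply (le_INR 1), Hn).
  destruct (MVT_gen (int_scaled n) (-5) t
    (fun u => sin_scaled n u / (1 + u ^ 2 / INR n))) as [xi [Hxi E]].
  - intros u _. apply is_derive_int_scaled, Hn.
  - intros u _. apply derivable_continuous_pt. eexists.
    apply is_derive_Reals, is_derive_int_scaled, Hn.
  - rewrite Rmin_left, Rmax_right in Hxi by lra.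
    assert (H5 : 0 < int_scaled n (-5)).
    { apply Rmult_lt_0_compat; [apply sqrt_INR_pos, Hn|].
      apply sin_int_pos. pose proof (rescale_bounds n (-5)). lra. }
    assert (Hxi2 : 0 <= xi ^ 2 <= 25) by nra.
    assert (Hv : 0 <= xi ^ 2 / INR n <= 25).
    { split; [apply div_INR_nonneg; [exact Hn | lra]|].
      apply Rle_div_l; [lra|]. nra. }
    assert (Hg : gauss 5 <= sin_scaled n xi).
    { apply Rle_trans with (gauss xi); [|apply gauss_le_sin_scaled, Hn].
      apply exp_nondecreasing. lra. }
    assert (Hq : gauss 5 / 26 <= sin_scaled n xi / (1 + xi ^ 2 / INR n)).
    { apply Rmult_le_compat; [left; apply gauss_pos| |exact Hg|].
      - left. apply Rinv_0_lt_compat. lra.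
      - apply Rinv_le_contravar; lra. }
    pose proof (gauss_pos 5). nra.
Qed.

(** b_n / sqrt n in the rescaled variable. *)
Definition b_scaled (n : nat) (t : R) : R :=
  t + 2 * (sin_scaled n t * / int_scaled n t).

(** The case al = be = 1/2 of [linear_sin_int_le]. *)
Lemma b_scaled_ge_1 (n : nat) (t : R) : (0 < n)%nat -> 1 <= b_scaled n t.
Proof.
  intros Hn. pose proof (rescale_bounds n t) as Hb.
  pose proof (linear_sin_int_le (1 / 2) (1 / 2) n (rescale n t) ltac:(lra)
    ltac:(intros p w; pose proof (pow2_ge_0 p); pose proof (pow2_ge_0 w); lra)
    Hn Hb) as H.
  pose proof (cos_rescale n t Hn) as Hc. pose proof (sin_rescale_pos n t) as Hs.
  pose proof (sqrt_INR_pos n Hn) as Hr.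
  assert (Hrr : sqrt (INR n) * sqrt (INR n) = INR n) by (apply sqrt_sqrt, pos_INR).
  assert (HI : 0 < int_scaled n t)
    by (apply Rmult_lt_0_compat; [exact Hr | apply sin_int_pos; lra]).
  assert (H' : (1 - t) / 2 * int_scaled n t <= sin_scaled n t).
  { unfold int_scaled, sin_scaled. rewrite <- tech_pow_Rmult in H.
    set (r := sqrt (INR n)) in *. rewrite <- Hrr in H.
    apply Rmult_le_reg_l with (sin (rescale n t)); [exact Hs|].
    replace (1 / 2 * (r * r) * cos (rescale n t))
      with (1 / 2 * r * (r * cos (rescale n t))) in H by ring.
    rewrite Hc in H. lra. }
  apply Rle_div_r in H'; [|exact HI]. unfold b_scaled, Rdiv in *. lra.
Qed.

(** The limit of phi_n'' in the rescaled variable. *)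
Definition phi_dd_lim (t : R) : R :=
  1 / 2 - (1 + t ^ 2 / 2) * (/ (t + 2 * (gauss t * / gauss_int t))) ^ 2.

Lemma CVU_phi_dd :
  CVU (fun n t => phi_dd n (rescale n t)) phi_dd_lim 0 window.
Proof.
  pose proof (gauss_pos 5) as Hg5.
  assert (Hd : 0 < gauss 5 / 26) by lra.
  assert (HA : forall n y, (0 < n)%nat -> Boule 0 window y ->
                 gauss 5 / 26 <= int_scaled n y)
    by (intros n y Hn Hy; apply int_scaled_lower; [exact Hn | apply in_window, Hy]).
  pose proof (CVU_lower_bound _ _ _ _ _ HA CVU_int_scaled) as HA'.
  assert (Hquot : CVU (fun n t => sin_scaled n t * / int_scaled n t)
                      (fun t => gauss t * / gauss_int t) 0 window).
  { apply CVU_mult with (Rmax 1 (/ (gauss 5 / 26))).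
    - intros y _. apply Rle_trans with 1; [|apply Rmax_l].
      rewrite Rabs_pos_eq; [apply gauss_le_1 | left; apply gauss_pos].
    - intros y Hy. apply Rle_trans with (/ (gauss 5 / 26)); [|apply Rmax_r].
      specialize (HA' y Hy).
      rewrite Rabs_pos_eq by (left; apply Rinv_0_lt_compat; lra).
      apply Rinv_le_contravar; lra.
    - apply CVU_sin_scaled.
    - apply (CVU_inv _ _ _ _ _ Hd HA CVU_int_scaled). }
  assert (HB : CVU b_scaled (fun t => t + 2 * (gauss t * / gauss_int t)) 0 window).
  { apply (CVU_plus 0 window (fun _ t => t)
      (fun n t => 2 * (sin_scaled n t * / int_scaled n t))); [apply CVU_const|].
    apply CVU_ext_eventually with (fun n t =>
      sin_scaled n t * / int_scaled n t + sin_scaled n t * / int_scaled n t);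
      [intros; ring|].
    apply CVU_ext_lim with (fun t =>
      gauss t * / gauss_int t + gauss t * / gauss_int t); [|intros; ring].
    apply CVU_plus; exact Hquot. }
  assert (HB1 : forall n y, (0 < n)%nat -> Boule 0 window y -> 1 <= b_scaled n y)
    by (intros; apply b_scaled_ge_1; assumption).
  pose proof (CVU_lower_bound _ _ _ _ _ HB1 HB) as HB1'.
  pose proof (CVU_inv _ _ _ _ _ Rlt_0_1 HB1 HB) as HBi.
  assert (Hinv : forall y, Boule 0 window y ->
    0 < / (y + 2 * (gauss y * / gauss_int y)) <= 1).
  { intros y Hy. specialize (HB1' y Hy). split; [apply Rinv_0_lt_compat; lra|].
    rewrite <- Rinv_1. apply Rinv_le_contravar; lra. }
  apply CVU_ext_eventually with (fun n t =>
    1 / 2 + - (1 + t ^ 2 / 2 + t ^ 2 / INR n) * (/ b_scaled n t * / b_scaled n t)).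
  { intros n t Hn. rewrite (phi_dd_rescale n t Hn). unfold b_scaled. ring. }
  apply CVU_ext_lim with (fun t => 1 / 2 + - (1 + t ^ 2 / 2) *
    (/ (t + 2 * (gauss t * / gauss_int t)) * / (t + 2 * (gauss t * / gauss_int t))));
    [|intros y _; unfold phi_dd_lim; ring].
  apply (CVU_plus 0 window (fun _ _ => 1 / 2)); [apply CVU_const|].
  apply CVU_mult with 9.
  - intros y Hy. apply in_window in Hy. rewrite Rabs_Ropp, Rabs_pos_eq; nra.
  - intros y Hy. specialize (Hinv y Hy). rewrite Rabs_pos_eq; nra.
  - apply CVU_of_rate with (fun n => 16 / INR n); [apply is_lim_seq_div_INR|].
    intros n y Hn Hy. apply in_window in Hy.
    assert (HN : 0 < INR n) by (apply lt_0_INR, Hn).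
    replace (- (1 + y ^ 2 / 2) - - (1 + y ^ 2 / 2 + y ^ 2 / INR n))
      with (y ^ 2 / INR n) by ring.
    rewrite Rabs_pos_eq by (apply div_INR_nonneg; [exact Hn | nra]).
    apply Rmult_le_compat_r; [left; apply Rinv_0_lt_compat; lra | nra].
  - apply CVU_mult with 1; try exact HBi;
      intros y Hy; specialize (Hinv y Hy); rewrite Rabs_pos_eq; lra.
Qed.

(** Near its minimum at t = 1.7 or so [phi_dd_lim] is about -0.18, so crude
    bounds suffice at t = 2: exp (-2) <= 1/7, and
    sqrt (PI/2) + int_0^2 (1 - u^2/2) du >= 1.88. *)
Lemma phi_dd_lim_2 : phi_dd_lim 2 < - (1 / 7).
Proof.
  assert (Hg : gauss 2 <= 1 / 7).
  { unfold gauss. replace (- (2 ^ 2 / 2)) with (- (INR 64 * (1 / 32)))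
      by (simpl; lra).
    rewrite exp_Ropp, <- exp_pow.
    replace (1 / 7) with (/ 7) by lra. apply Rinv_le_contravar; [lra|].
    (* exp 2 = exp (1/32)^64 and (1 + 1/32)^64 > 7 *)
    apply Rle_trans with ((33 / 32) ^ 64); [lra|].
    apply pow_incr. pose proof (exp_ineq1_le (1 / 32)). lra. }
  pose proof (gauss_pos 2) as Hg0.
  assert (HA : 1.88 <= gauss_int 2).
  { assert (H : gauss_int 0 - 0 <= gauss_int 2 - (2 - 2 ^ 3 / 6)).
    { replace (gauss_int 0 - 0) with (gauss_int 0 - (0 - 0 ^ 3 / 6)) by lra.
      apply (le_of_deriv_nonneg (fun u => gauss_int u - (u - u ^ 3 / 6))
        (fun u => gauss u - (1 - u ^ 2 / 2))); [lra| |].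
      - intros u _. apply (is_derive_minus gauss_int (fun u => u - u ^ 3 / 6)).
        + apply is_derive_gauss_int.
        + auto_derive; [trivial | field].
      - intros u _. unfold gauss. pose proof (exp_ineq1_le (- (u ^ 2 / 2))). lra. }
    rewrite gauss_int_0 in H.
    assert (1.22 <= sqrt (PI / 2)).
    { rewrite <- (sqrt_pow2 1.22) by lra. apply sqrt_le_1_alt.
      pose proof PI2_3_2. lra. }
    lra. }
  unfold phi_dd_lim.
  assert (Hq : 0 < gauss 2 * / gauss_int 2 <= 0.077).
  { split; [apply Rmult_lt_0_compat; [|apply Rinv_0_lt_compat]; lra|].
    apply (Rle_div_l (gauss 2)); lra. }
  set (q := gauss 2 * / gauss_int 2) in *.
  assert (Hi : / 2.154 <= / (2 + 2 * q)) by (apply Rinv_le_contravar; lra).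
  assert (Hsq : (/ 2.154) ^ 2 <= (/ (2 + 2 * q)) ^ 2)
    by (apply pow_incr; split; [lra | exact Hi]).
  lra.
Qed.

Lemma phi_dd_low_in_window (n : nat) (x : R) :
  (100 <= n)%nat -> 0 <= x <= PI -> phi_dd n x < - (1 / 7) ->
  exists t, -4 < t < 4 /\ rescale n t = x.
Proof.
  intros Hn Hx Hlow.
  assert (HN : 100 <= INR n) by (replace 100 with (INR 100) by (simpl; lra);
    apply le_INR, Hn).
  assert (Hinv : 1 / INR n <= 1 / 100)
    by (apply Rmult_le_compat_l; [|apply Rinv_le_contravar]; lra).
  assert (Hr : sqrt (INR n) * sqrt (INR n) = INR n) by (apply sqrt_sqrt; lra).
  assert (Hends : sin x <> 0).
  { intros Hs. pose proof (sin2_cos2 x) as H. unfold Rsqr in H. rewrite Hs in H.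
    assert (Hc : cos x <> 0) by (intros Hc; rewrite Hc in H; lra).
    pose proof (phi_dd_tail n x ltac:(lia) Hx Hc) as Ht. rewrite Hs in Ht.
    unfold Rdiv in Ht at 2. rewrite pow_i, Rmult_0_l in Ht by lia. lra. }
  assert (Hx' : 0 < x < PI).
  { split.
    - destruct (proj1 Hx) as [H | <-]; [exact H|]. rewrite sin_0 in Hends. lra.
    - destruct (proj2 Hx) as [H | ->]; [exact H|]. rewrite sin_PI in Hends. lra. }
  assert (Hs : 0 < sin x) by (apply sin_gt_0; lra).
  exists (- (sqrt (INR n) * cos x / sin x)).
  split; [|apply rescale_surj; [lia | exact Hx']].
  enough (Habs : Rabs (sqrt (INR n) * cos x / sin x) < 4)
    by (apply Rabs_def2 in Habs; lra).
  apply Rnot_le_lt. intros Hbig.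
  assert (Hc : cos x <> 0).
  { intros Hc. rewrite Hc in Hbig. unfold Rdiv in Hbig.
    rewrite Rmult_0_r, Rmult_0_l, Rabs_R0 in Hbig. lra. }
  pose proof (phi_dd_tail n x ltac:(lia) Hx Hc) as Ht.
  assert (Hsq : 4 ^ 2 <= (sqrt (INR n) * cos x / sin x) ^ 2).
  { rewrite <- (pow2_abs (sqrt _ * _ / _)). apply pow_incr. lra. }
  replace ((sqrt (INR n) * cos x / sin x) ^ 2)
    with (INR n * cos x ^ 2 / sin x ^ 2) in Hsq
    by (rewrite <- Hr at 1; field; lra).
  apply Rle_div_r in Hsq; [|apply pow_lt, Hs].
  assert (Hc2 : 0 < INR n * cos x ^ 2) by (apply Rmult_lt_0_compat; nra).
  assert (sin x ^ 2 / (INR n * cos x ^ 2) <= 1 / 16)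
    by (apply Rle_div_l; [exact Hc2 | lra]).
  lra.
Qed.

(** * The sequence of minima *)

(** The minimum of phi_n'' over [0, PI], written as an infimum. *)
Definition min_phi_dd (n : nat) : R :=
  real (Glb_Rbar (fun y => exists x, 0 <= x <= PI /\ phi_dd n x = y)).

Lemma is_min_min_phi_dd (n : nat) :
  is_min_on (fun x => 0 <= x <= PI) (phi_dd n) (min_phi_dd n).
Proof.
  destruct (phi_dd_has_min n) as [m [Hatt Hmin]].
  replace (min_phi_dd n) with m; [split; assumption|].
  unfold min_phi_dd. rewrite (is_glb_Rbar_unique _ (Finite m)); [reflexivity|].
  split.
  - intros y [x [Hx <-]]. apply Hmin, Hx.
  - intros b Hb. destruct Hatt as [x [Hx E]]. apply Hb. exists x. auto.
Qed.

Lemma min_phi_dd_upper :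
  eventually (fun n => min_phi_dd n < - (1 / 7)).
Proof.
  pose proof phi_dd_lim_2 as H2.
  destruct (CVU_phi_dd (- (1 / 7) - phi_dd_lim 2) ltac:(lra)) as [N HN].
  exists N. intros n Hn.
  specialize (HN n 2 Hn ltac:(apply in_window; lra)). apply Rabs_def2 in HN.
  pose proof (rescale_bounds n 2).
  pose proof (proj2 (is_min_min_phi_dd n) (rescale n 2) ltac:(lra)). lra.
Qed.

Lemma min_phi_dd_lower :
  eventually (fun n => - (5 / 11) <= min_phi_dd n).
Proof.
  exists 100%nat. intros n Hn.
  destruct (is_min_min_phi_dd n) as [[x [Hx <-]] _]. apply phi_dd_lower; assumption.
Qed.

Lemma min_phi_dd_cauchy : ex_finite_lim_seq min_phi_dd.
Proof.
  apply ex_lim_seq_cauchy_corr. intros eps.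
  pose proof (cond_pos eps) as Heps.
  destruct (CVU_phi_dd (eps / 2) ltac:(lra)) as [N1 H1].
  destruct min_phi_dd_upper as [N2 H2].
  assert (Hle : forall n m, (max 100 (max N1 N2) <= n)%nat ->
     (max 100 (max N1 N2) <= m)%nat -> min_phi_dd m < min_phi_dd n + eps).
  { intros n m Hn Hm.
    destruct (is_min_min_phi_dd n) as [[x [Hx Ex]] _].
    (* Compare at the rescaled point where the n-th minimum is attained. *)
    destruct (phi_dd_low_in_window n x ltac:(lia) Hx) as [t [Ht <-]].
    { rewrite Ex. apply H2. lia. }
    pose proof (H1 n t ltac:(lia) (proj2 (in_window t) Ht)) as Dn.
    pose proof (H1 m t ltac:(lia) (proj2 (in_window t) Ht)) as Dm.
    apply Rabs_def2 in Dn. apply Rabs_def2 in Dm.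
    pose proof (rescale_bounds m t).
    pose proof (proj2 (is_min_min_phi_dd m) (rescale m t) ltac:(lra)). lra. }
  exists (max 100 (max N1 N2)). intros n m Hn Hm.
  pose proof (Hle n m Hn Hm). pose proof (Hle m n Hm Hn). apply Rabs_def1; lra.
Qed.

Theorem proposition25 (phi : nat -> R -> R)
    (Hphi : forall n : nat, is_phi n (phi n)) :
  exists (phi2 : nat -> R -> R) (m : nat -> R) (l : R),
    (forall n : nat, is_second_derivative (phi n) (phi2 n)) /\
    (forall n : nat, is_min_on (fun x => 0 <= x <= PI) (phi2 n) (m n)) /\
    is_lim_seq m (Finite l) /\
    - (5 / 11) <= l <= - (1 / 7).
Proof.
  destruct min_phi_dd_cauchy as [l Hl].
  exists phi_dd, min_phi_dd, l. split; [|split; [|split; [|split]]].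
  - intros n. apply is_second_derivative_phi_dd, Hphi.
  - exact is_min_min_phi_dd.
  - exact Hl.
  - apply (is_lim_seq_le_loc (fun _ => - (5 / 11)) min_phi_dd
      (Finite (- (5 / 11))) (Finite l));
      [exact min_phi_dd_lower | apply is_lim_seq_const | exact Hl].
  - apply (is_lim_seq_le_loc min_phi_dd (fun _ => - (1 / 7))
      (Finite l) (Finite (- (1 / 7)))); [|exact Hl | apply is_lim_seq_const].
    generalize min_phi_dd_upper. apply filter_imp. intros n Hn. lra.
Qed.
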